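(* Let $X_1=\mathbb{R}^6_{\ge0}$ with coordinates $x,y,z,u,v,w$, and let $G$ be the group of coordinate permutations generated by $(u\ v)(y\ z)$, $(v\ w)(x\ y)$ and $(v\ x)(w\ y)$ (so $G\cong\mathrm{Sym}(4)$), with quotient map $q:X_1\to\mathbb{M}_{K_4}=X_1/G$. Let $P=\{(x,y,z,u,v,w)\in X_1:\max\{x,y\}\le u,\ \max\{x,z\}\le v,\ \max\{y,z\}\le w\}$ (the honeycomb cone), $P'=\bigcup_{g\in G}gP$ its $G$-sweep, and $\mathbb{M}^{\mathrm{pl}}_{K_4}=q(P')$. Consider the stacky fan structure on $\mathbb{M}^{\mathrm{pl}}_{K_4}$ obtained from the fundamental domain $D=P\cap\{u\ge v\ge w\}$ by identifying faces of $D$ whose $G$-orbits intersect. Then this stacky fan has face vector $(7,18,25,21,8)$ (numbers of cells of dimensions $1,2,3,4,5$), and its link $q(P'\cap\{x+y+z+u+v+w=1\})$ has trivial (reduced integral) homology.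
   Context: $\mathbb{M}_{K_4}$ is the moduli cell of genus 3 tropical curves whose underlying graph is the complete graph $K_4$ with edge lengths $x,y,z,u,v,w$, and $\mathbb{M}^{\mathrm{pl}}_{K_4}$ is the locus of tropical honeycomb curves (tropically smooth plane $K_4$-curves and their closure). The link of a stacky fan is the image of its intersection with the hyperplane where the coordinates sum to 1. *)

(* Defs.v *)
From HB Require Import structures.
From mathcomp Require Import all_boot all_order all_algebra all_fingroup.
From mathcomp Require Import all_classical all_reals all_analysis.
From mathcomp Require Import generic_quotient.
From Stdlib Require List.
Set Implicit Arguments.
Unset Strict Implicit.
Unset Printing Implicit Defensive.
Import Order.TTheory GRing.Theory Num.Theory.
Import numFieldNormedType.Exports.
Local Open Scope classical_set_scope.
Local Open Scope ring_scope.
Local Open Scope quotient_scope.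

Definition c6 (k : nat) : 'I_6 := inord k.

Definition genK1 : {perm 'I_6} := (tperm (c6 3) (c6 4) * tperm (c6 1) (c6 2))%g.
Definition genK2 : {perm 'I_6} := (tperm (c6 4) (c6 5) * tperm (c6 0) (c6 1))%g.
Definition genK3 : {perm 'I_6} := (tperm (c6 4) (c6 0) * tperm (c6 5) (c6 1))%g.

Definition GK4 : {group {perm 'I_6}} := <<([set genK1; genK2; genK3])%SET>>%G.

Section K4.
Context {R : realType}.

Definition pact (g : {perm 'I_6}) (p : 'rV[R]_6) : 'rV[R]_6 := \row_i p 0 (g i).

Lemma pact1 p : pact 1%g p = p.
Proof. by apply/rowP => i; rewrite mxE perm1. Qed.

Lemma pactM g h p : pact g (pact h p) = pact (g * h)%g p.
Proof. by apply/rowP => i; rewrite !mxE permM. Qed.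

Definition xc (p : 'rV[R]_6) := p 0 (c6 0).
Definition yc (p : 'rV[R]_6) := p 0 (c6 1).
Definition zc (p : 'rV[R]_6) := p 0 (c6 2).
Definition uc (p : 'rV[R]_6) := p 0 (c6 3).
Definition vc (p : 'rV[R]_6) := p 0 (c6 4).
Definition wc (p : 'rV[R]_6) := p 0 (c6 5).

Definition X1 : set 'rV[R]_6 := [set p | forall i, 0 <= p 0 i].

Definition honeycomb : set 'rV[R]_6 :=
  X1 `&` [set p | Num.max (xc p) (yc p) <= uc p /\
                  Num.max (xc p) (zc p) <= vc p /\
                  Num.max (yc p) (zc p) <= wc p].

Definition sweep : set 'rV[R]_6 :=
  \bigcup_(g in [set g | g \in GK4]) (pact g @` honeycomb).

Definition fundD : set 'rV[R]_6 :=
  honeycomb `&` [set p | uc p >= vc p /\ vc p >= wc p].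

Definition orbit_rel : rel 'rV[R]_6 :=
  fun p p' => [exists g in GK4, pact g p == p'].

Lemma orbit_rel_refl : reflexive orbit_rel.
Proof. by move=> p; apply/existsP; exists 1%g; rewrite group1 pact1 eqxx. Qed.

Lemma orbit_rel_sym : symmetric orbit_rel.
Proof.
suff H : forall p p', orbit_rel p p' -> orbit_rel p' p.
  by move=> p p'; apply/idP/idP; apply: H.
move=> p p' /existsP [g /andP [gG /eqP <-]].
by apply/existsP; exists g^-1%g; rewrite groupV gG /= pactM mulVg pact1.
Qed.

Lemma orbit_rel_trans : transitive orbit_rel.
Proof.
move=> p2 p1 p3 /existsP [g /andP [gG /eqP <-]] /existsP [h /andP [hG /eqP <-]].
by apply/existsP; exists (h * g)%g; rewrite groupM // pactM eqxx.
Qed.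

Definition orbit_equiv : equiv_rel 'rV[R]_6 :=
  EquivRel orbit_rel orbit_rel_refl orbit_rel_sym orbit_rel_trans.

Definition MK4 : topologicalType := quotient_topology {eq_quot orbit_equiv}.

Definition qK4 : 'rV[R]_6 -> MK4 := \pi_(quotient_topology {eq_quot orbit_equiv}).

Definition linkK4 : set MK4 :=
  qK4 @` (sweep `&` [set p | \sum_i p 0 i = 1]).

Definition lin (a p : 'rV[R]_6) : R := \sum_i a 0 i * p 0 i.

Definition is_face (C F : set 'rV[R]_6) : Prop :=
  exists a : 'rV[R]_6, (forall p, C p -> 0 <= lin a p) /\
                       F = C `&` [set p | lin a p = 0].

Definition span_dim (F : set 'rV[R]_6) (k : nat) : Prop :=
  exists M : 'M[R]_(k, 6), (forall i, F (row i M)) /\ \rank M = k /\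
                           (forall p, F p -> (p <= M)%MS).

(* faces are identified when their G-orbits intersect, i.e. gF = F' for some g *)
Definition face_equiv (F F' : set 'rV[R]_6) : Prop :=
  exists2 g, g \in GK4 & pact g @` F = F'.

Definition num_cells (C : set 'rV[R]_6) (k N : nat) : Prop :=
  exists rep : 'I_N -> set 'rV[R]_6,
    (forall i, is_face C (rep i) /\ span_dim (rep i) k) /\
    (forall i j, face_equiv (rep i) (rep j) -> i = j) /\
    (forall F, is_face C F -> span_dim F k -> exists i, face_equiv F (rep i)).

Definition std_simplex (n : nat) : set 'rV[R]_n.+1 :=
  [set t | (forall i, 0 <= t 0 i) /\ \sum_i t 0 i = 1].

Definition coface (n i : nat) (t : 'rV[R]_n.+1) : 'rV[R]_n.+2 :=
  \row_(j < n.+2) (if (j < i)%N then t 0 (inord j)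
                   else if (j == i :> nat) then 0 else t 0 (inord j.-1)).

Section Homology.
Context {T : topologicalType}.

Definition singular (n : nat) (A : set T) (s : 'rV[R]_n.+1 -> T) : Prop :=
  {within @std_simplex n, continuous s} /\ s @` @std_simplex n `<=` A.

Definition chain (n : nat) := seq (int * ('rV[R]_n.+1 -> T)).

Definition is_chain (n : nat) (A : set T) (c : chain n) : Prop :=
  forall p, List.In p c -> singular A p.2.

(* coefficient of the singular simplex s in c (two simplices are the same
   when they agree on the standard simplex) *)
Definition coef (n : nat) (c : chain n) (s : 'rV[R]_n.+1 -> T) : int :=
  \sum_(p <- c)
     (if `[< forall t, @std_simplex n t -> p.2 t = s t >] then p.1 else 0).

Definition boundary (n : nat) (c : chain n.+1) : chain n :=
  flatten [seq [seq (((-1) ^+ i) * p.1, fun t => p.2 (coface i t))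
               | i <- iota 0 n.+2] | p <- c].

(* the reduced singular homology (Z coefficients) of the subspace A vanishes:
   the augmented singular chain complex of A is exact in every degree >= -1 *)
Definition reduced_acyclic (A : set T) : Prop :=
  A !=set0 /\
  (forall c : chain 0, is_chain A c -> \sum_(p <- c) p.1 = 0 ->
     exists d : chain 1, is_chain A d /\ forall s, coef (boundary d) s = coef c s) /\
  (forall n (c : chain n.+1), is_chain A c ->
     (forall s, coef (boundary c) s = 0) ->
     exists d : chain n.+2, is_chain A d /\ forall s, coef (boundary d) s = coef c s).

End Homology.
End K4.

(* Main.v *)
Require Import Defs.
From HB Require Import structures.
From mathcomp Require Import all_boot all_order all_algebra all_fingroup.
From mathcomp Require Import all_classical all_reals all_analysis.
From mathcomp Require Import generic_quotient lra ring.
Set Implicit Arguments.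
Unset Strict Implicit.
Unset Printing Implicit Defensive.
Import Order.TTheory GRing.Theory Num.Theory.
Import numFieldNormedType.Exports.
Local Open Scope classical_set_scope.
Local Open Scope ring_scope.

(* D is the cone {u >= v >= w, v >= x >= 0, w >= y >= 0, w >= z >= 0} of
   order-preserving functions on a tree poset, so it is spanned by the
   indicators of the 11 nonempty filters. These form a distributive lattice L
   under intersection and union. As 1_A + 1_B = 1_(A n B) + 1_(A u B), the rays
   on a face form a subset S of L such that A, B lie in S iff A n B, A u B do;
   conversely each such S is cut out by the facets containing it, its dimension
   is the length of a maximal chain in S, and two faces are identified iff one
   of the 24 elements of G carries one set of rays to the other. The face
   numbers are thereby reduced to a finite computation.

   The point b = (1/6, ..., 1/6) is fixed by G and lies in every gP, each of
   which is convex. Hence the slice of P' is star-shaped around b by a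
   G-equivariant homotopy, which descends to a contraction of the link, and
   coning off singular simplices along that contraction kills the reduced
   homology. *)

(** * The lattice of rays of D *)

Fixpoint bitseqs n : seq bitseq :=
  if n is n'.+1 then [seq b :: s | b <- [:: false; true], s <- bitseqs n']
  else [:: [::]].

Lemma mem_bitseqs s : s \in bitseqs (size s).
Proof.
by elim: s => // b s IHs; apply/allpairsP; exists (b, s); case: b; split.
Qed.

(* Listed by increasing cardinality: [chain_from] relies on this order. *)
Definition rays : seq bitseq := [seq [seq b == 1%N | b <- r] | r <-
  [:: [:: 0; 0; 0; 1; 0; 0]; [:: 0; 0; 0; 1; 1; 0]; [:: 0; 0; 0; 1; 1; 1];
      [:: 1; 0; 0; 1; 1; 0]; [:: 1; 0; 0; 1; 1; 1]; [:: 0; 1; 0; 1; 1; 1];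
      [:: 0; 0; 1; 1; 1; 1]; [:: 1; 1; 0; 1; 1; 1]; [:: 1; 0; 1; 1; 1; 1];
      [:: 0; 1; 1; 1; 1; 1]; [:: 1; 1; 1; 1; 1; 1]]]%N.

Definition meetb (a b : bitseq) : bitseq := [seq p.1 && p.2 | p <- zip a b].
Definition joinb (a b : bitseq) : bitseq := [seq p.1 || p.2 | p <- zip a b].

Definition embedded (S : seq bitseq) : bool :=
  all (fun a => all (fun b =>
    ((a \in S) && (b \in S)) == ((meetb a b \in S) && (joinb a b \in S)))
    rays) rays.

Definition faces : seq (seq bitseq) :=
  [seq S <- [seq mask m rays | m <- bitseqs (size rays)] | embedded S].

Definition dotz (a : seq int) (b : bitseq) : int :=
  foldr (fun j s => a`_j * (nth false b j : nat)%:Z + s) 0 (iota 0 6).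

Definition facets : seq (seq int) :=
  [:: [:: 1; 0; 0; 0; 0; 0]; [:: 0; 1; 0; 0; 0; 0]; [:: 0; 0; 1; 0; 0; 0];
      [:: 0; 0; 0; 1; -1; 0]; [:: 0; 0; 0; 0; 1; -1]; [:: -1; 0; 0; 0; 1; 0];
      [:: 0; -1; 0; 0; 0; 1]; [:: 0; 0; -1; 0; 0; 1]].

(** A sum of functionals nonnegative on D vanishes exactly where every summand does, so this one
    form cuts out the intersection of all facets through S. *)
Definition face_form (S : seq bitseq) : seq int :=
  let fs := [seq f <- facets | all (fun r => dotz f r == 0) S] in
  mkseq (fun j => foldr (fun f s => f`_j + s) 0 fs) 6.

(* On an embedded sublattice this greedy chain is maximal, hence its indicators
   form a basis of the linear span of S. *)
Fixpoint chain_from (a : bitseq) (S : seq bitseq) : seq bitseq :=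
  if S is r :: S' then
    if meetb a r == a then r :: chain_from r S' else chain_from a S'
  else [::].

Definition max_chain (S : seq bitseq) : seq bitseq := chain_from (nseq 6 false) S.

Definition face_dim (S : seq bitseq) : nat := size (max_chain S).

(* Differences of coordinates, dual to the basis [max_chain S]. *)
Definition dual_chain (S : seq bitseq) : seq (seq int) :=
  let ch := max_chain S in
  let e j := index true [seq p.1 && ~~ p.2 |
    p <- zip (nth [::] ch j) (nth (nseq 6 false) (nseq 6 false :: ch) j)] in
  mkseq (fun j => mkseq (fun i => (i == e j)%:Z -
                    ((j.+1 < size ch)%N && (i == e j.+1))%:Z) 6) (size ch).

(** The conjuncts say in turn that the form is nonnegative on rays and vanishes on those in S only,
    that the chain lies in S, that the dual functionals make it linearly independent, and that they
    expand each ray of S in it. *)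
Definition face_certificate (S : seq bitseq) : bool :=
  let a := face_form S in
  let ch := max_chain S in
  let du := dual_chain S in
  [&& all (fun r => (0 <= dotz a r) && ((dotz a r == 0) == (r \in S))) rays,
      all (mem S) ch,
      all (fun i => all (fun j =>
        dotz (nth [::] du j) (nth [::] ch i) == (i == j)%:Z)
        (iota 0 (size ch))) (iota 0 (size ch))
    & all (fun r => all (fun i => (nth false r i)%:Z ==
        foldr (fun j s => dotz (nth [::] du j) r *
                          (nth false (nth [::] ch j) i)%:Z + s)
              0 (iota 0 (size ch))) (iota 0 6)) S].

Lemma faces_certified : all face_certificate faces.
Proof. by vm_compute. Qed.

(** * Enumeration of G and of the face orbits *)

Definition comp_code (c d : seq nat) : seq nat := [seq nth 0%N d k | k <- c].

Definition gen_codes : seq (seq nat) :=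
  [:: [:: 0; 2; 1; 4; 3; 5]; [:: 1; 0; 2; 3; 5; 4]; [:: 4; 5; 2; 3; 0; 1]]%N.

(** Six rounds of multiplication by the generators exhaust G: [code_in_codes] checks that the result
    is closed under composition. *)
Definition codes : seq (seq nat) :=
  iter 6 (fun l => undup (l ++ [seq comp_code g c | g <- gen_codes, c <- l]))
       [:: iota 0 6].

Definition actb (c : seq nat) (b : bitseq) : bitseq := [seq nth false b k | k <- c].

(** An identification of faces directly yields only this one-sided inclusion. Representatives are
    therefore separated by it in both directions, whereas covering uses the exact test
    [face_eqv]. *)
Definition face_le (S S' : seq bitseq) : bool :=
  has (fun c => all (fun r => actb c r \in S') S) codes.

Definition face_eqv (S S' : seq bitseq) : bool :=
  has (fun c => all (fun r => actb c r \in S') S &&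
                all (fun r => r \in [seq actb c s | s <- S]) S') codes.

Definition face_reps (k : nat) : seq (seq bitseq) :=
  foldr (fun S l => if has (face_eqv S) l then l else S :: l) [::]
        [seq S <- faces | face_dim S == k].

Definition in_order_cone (b : bitseq) : bool :=
  [&& nth false b 0 ==> nth false b 4, nth false b 1 ==> nth false b 5,
      nth false b 2 ==> nth false b 5, nth false b 5 ==> nth false b 4
    & nth false b 4 ==> nth false b 3].

Definition count_certificate (k N : nat) : bool :=
  let fk := [seq S <- faces | face_dim S == k] in
  let rk := face_reps k in
  [&& size rk == N, uniq rk, all (mem fk) rk,
      all (fun S => all (fun S' => (face_le S S' && face_le S' S) ==> (S == S'))
         rk) rk
    & all (fun S => has (face_eqv S) rk) fk].

Lemma face_counts : [&& count_certificate 1 7, count_certificate 2 18,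
  count_certificate 3 25, count_certificate 4 21 & count_certificate 5 8].
Proof. by vm_compute. Qed.

(** G may carry a ray out of D, but a nonzero 0/1 vector that stays in D is the indicator of a
    nonempty filter. *)
Lemma codes_rays : all (fun c => all (fun r =>
  in_order_cone (actb c r) ==> (actb c r \in rays)) rays) codes.
Proof. by vm_compute. Qed.

(** * The group G as permutations of coordinates *)

Definition code (g : {perm 'I_6}) : seq nat := [seq (g (inord k) : nat) | k <- iota 0 6].

Lemma nth_code g (i : 'I_6) : nth 0%N (code g) i = g i.
Proof. by rewrite (nth_map 0%N) ?size_iota // nth_iota // add0n inord_val. Qed.

Lemma size_code g : size (code g) = 6.
Proof. by rewrite size_map size_iota. Qed.

Lemma codeM g h : code (g * h)%g = comp_code (code g) (code h).
Proof.
rewrite /comp_code [code g]/code -map_comp; apply/eq_in_map => k _.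
by rewrite permM [RHS]nth_code.
Qed.

Lemma code1 : code 1%g = iota 0 6.
Proof.
apply: (@eq_from_nth _ 0%N) => [|i]; rewrite size_code ?size_iota // => i6.
by rewrite (nth_code _ (Ordinal i6)) perm1 nth_iota.
Qed.

Lemma c6_ind (P : 'I_6 -> Prop) :
  P (c6 0) -> P (c6 1) -> P (c6 2) -> P (c6 3) -> P (c6 4) -> P (c6 5) ->
  forall i, P i.
Proof.
move=> P0 P1 P2 P3 P4 P5 i; rewrite -[i]inord_val.
by case: i => -[|[|[|[|[|[|]]]]]].
Qed.

Lemma code_gens : [/\ code genK1 = nth [::] gen_codes 0,
  code genK2 = nth [::] gen_codes 1 & code genK3 = nth [::] gen_codes 2].
Proof.
by split; rewrite /code /= !permM !permE /= /c6 -!(inj_eq val_inj) /= !inordK.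
Qed.

Lemma code_in_codes g : g \in GK4 -> code g \in codes.
Proof.
move=> gG; pose H := [set g | code g \in codes]%SET.
have inH h : (h \in H) = (code h \in codes) by rewrite finset.in_set.
suff gH : group_set H.
  rewrite -inH; apply: (fintype.subsetP _ g gG).
  rewrite -[H]/(gval (Group gH)) gen_subG; apply/fintype.subsetP => h hs.
  suff: code h \in codes by rewrite -inH.
  have [e1 e2 e3] := code_gens.
  case/finset.setUP: hs => [/finset.setUP[]|] /finset.set1P ->;
  [rewrite e1|rewrite e2|rewrite e3]; by vm_compute.
apply/group_setP; split; first by rewrite inH code1; vm_compute.
move=> a b; rewrite !inH codeM => ca cb.
(* Closure under products is checked on all pairs of listed codes. *)
suff /allP/(_ _ ca)/allP/(_ _ cb) : all (fun c => all (fun d =>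
  comp_code c d \in codes) codes) codes by [].
by vm_compute.
Qed.

(** The enumeration stays inside G, as each round composes generators with codes already
    realized. *)
Lemma codes_realized c : c \in codes -> exists2 g, g \in GK4 & code g = c.
Proof.
move: c; pose ok (l : seq (seq nat)) :=
  forall c, c \in l -> exists2 g, g \in GK4 & code g = c.
have ok0 : ok [:: iota 0 6].
  by move=> d; rewrite inE => /eqP ->; exists 1%g; rewrite ?group1 ?code1.
have gen_ok d : d \in gen_codes -> exists2 g, g \in GK4 & code g = d.
  have [e1 e2 e3] := code_gens.
  rewrite !inE => /or3P[] /eqP ->; [exists genK1|exists genK2|exists genK3] => //;
  by apply: mem_gen; rewrite !inE eqxx ?orbT.
suff step l : ok l ->
    ok (undup (l ++ [seq comp_code g c | g <- gen_codes, c <- l])).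
  by do 6 apply: (step); exact: ok0.
move=> okl d; rewrite mem_undup mem_cat => /orP[/okl //|].
case/allpairsP => -[a b] /= [/gen_ok[g gG <-] /okl[h hG <-] ->].
by exists (g * h)%g; [exact: groupM | exact: codeM].
Qed.

(** * Faces of D *)

Section Order_cone.
Variable R : realType.
Implicit Types (p a : 'rV[R]_6) (b r : bitseq) (S : seq bitseq).

Lemma pact_linear (g : {perm 'I_6}) : linear (pact (R := R) g).
Proof. by move=> k p q; apply/rowP => i; rewrite !mxE. Qed.

HB.instance Definition _ (g : {perm 'I_6}) :=
  GRing.isLinear.Build R 'rV[R]_6 'rV[R]_6 _ (pact g) (pact_linear g).

Lemma lin_linear a : linear (lin a : 'rV[R]_6 -> R^o).
Proof.
move=> k p q; rewrite /lin scaler_sumr -big_split /=; apply: eq_bigr => i _.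
by rewrite !mxE mulrDr mulrCA.
Qed.

HB.instance Definition _ a :=
  GRing.isLinear.Build R 'rV[R]_6 R^o _ (lin a) (lin_linear a).

Definition rv b : 'rV[R]_6 := \row_j (nth false b j)%:R.
Definition iv (s : seq int) : 'rV[R]_6 := \row_j (s`_j)%:~R.

(** Transfers the integer certificates to real vectors. *)
Lemma lin_iv_rv s b : lin (iv s) (rv b) = (dotz s b)%:~R.
Proof.
rewrite /lin !big_ord_recl big_ord0 /dotz /= !mxE /= !rmorphD !rmorphM rmorph0 /=.
by rewrite /bump /= -!pmulrn.
Qed.

Lemma pact_rv g b : pact g (rv b) = rv (actb (code g) b).
Proof.
apply/rowP => i; rewrite !mxE /actb (nth_map 0%N) ?nth_code //.
Qed.

Lemma rv_c6 b k : (k < 6)%N -> rv b 0 (c6 k) = (nth false b k)%:R.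
Proof. by move=> k6; rewrite mxE inordK. Qed.

(** The bounds x, y <= u and z <= v and the signs of u, v, w follow by transitivity; the eight
    inequalities left are those of [facets]. *)
Lemma fundDP p : fundD p <-> [/\ [/\ 0 <= xc p, 0 <= yc p & 0 <= zc p],
   xc p <= vc p, yc p <= wc p, zc p <= wc p & wc p <= vc p /\ vc p <= uc p].
Proof.
rewrite /fundD /honeycomb /X1 /= !ge_max; split.
  move=> [[p0 [/andP[? ?] [/andP[? ?] /andP[? ?]]]] [? ?]].
  by split=> //; split; exact: p0.
move=> [[x0 y0 z0] xv yw zw [wv vu]]; split => //; split.
  by apply: c6_ind; rewrite -?/(xc p) -?/(yc p) -?/(zc p) -?/(wc p)
    -?/(uc p) -?/(vc p); lra.
by do !split; apply/andP; split; lra.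
Qed.

Definition combination (s : seq (R * bitseq)) : 'rV[R]_6 :=
  \sum_(e <- s) e.1 *: rv e.2.

Definition nonneg_on S (s : seq (R * bitseq)) : bool :=
  all (fun e => (0 <= e.1) && (e.2 \in S)) s.

Lemma fundD_rv b : in_order_cone b -> fundD (rv b).
Proof.
case/and5P => h1 h2 h3 h4 h5; apply/fundDP.
rewrite /xc /yc /zc /uc /vc /wc !rv_c6 //; split; [split; exact: ler0n|..].
all: rewrite ?ler_nat.
- by move: h1; do 2 case: nth.
- by move: h2; do 2 case: nth.
- by move: h3; do 2 case: nth.
by split; [move: h4|move: h5]; do 2 case: nth.
Qed.

Lemma rv_fundD b : fundD (rv b) -> in_order_cone b.
Proof.
move/fundDP; rewrite /xc /yc /zc /uc /vc /wc !rv_c6 //.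
case=> _; rewrite !ler_nat => h1 h2 h3 [h4 h5]; apply/and5P; split.
- by move: h1; do 2 case: nth.
- by move: h2; do 2 case: nth.
- by move: h3; do 2 case: nth.
- by move: h4; do 2 case: nth.
by move: h5; do 2 case: nth.
Qed.

Lemma fundD_ray r : r \in rays -> fundD (rv r).
Proof.
move=> rr; apply: fundD_rv; move: r rr; apply/allP; by vm_compute.
Qed.

Lemma fundD_combination s : nonneg_on rays s -> fundD (combination s).
Proof.
move=> /allP s0; rewrite /combination big_seq; apply: big_ind.
- by apply/fundDP; rewrite /xc /yc /zc /uc /vc /wc !mxE lexx.
- move=> p q /fundDP + /fundDP + ; rewrite /xc /yc /zc /uc /vc /wc => hp hq.
  apply/fundDP; rewrite /xc /yc /zc /uc /vc /wc !mxE.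
  case: hp => -[? ? ?] ? ? ? [? ?]; case: hq => -[? ? ?] ? ? ? [? ?].
  by do !split; lra.
move=> e /s0/andP[e0 /fundD_ray/fundDP]; rewrite /xc /yc /zc /uc /vc /wc => hp.
have eZ k : (e.1 *: rv e.2) 0 k = e.1 * rv e.2 0 k by rewrite mxE.
apply/fundDP; rewrite /xc /yc /zc /uc /vc /wc !eZ.
case: hp => -[? ? ?] ? ? ? [? ?].
by do !split; rewrite ?mulr_ge0 ?ler_wpM2l.
Qed.

Ltac solve_coordinates :=
  apply: c6_ind; rewrite !rv_c6 //= ?mulr1 ?mulr0 ?add0r ?addr0
    /xc /yc /zc /uc /vc /wc; ring.

(* For each of the eight orderings compatible with the inequalities of D, the
   superlevel sets of the coordinates form a chain of rays. *)
Lemma fundD_decomposition p :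
  fundD p -> exists2 s, nonneg_on rays s & p = combination s.
Proof.
move/fundDP => [[x0 y0 z0] xv yw zw [wv vu]].
pose ray n := nth [::] rays n.
have ok (s : seq (R * nat)) : all (fun e => (0 <= e.1) && (e.2 < 11)%N) s ->
    p = \sum_(e <- s) e.1 *: rv (ray e.2) ->
    exists2 s, nonneg_on rays s & p = combination s.
  move=> /allP s0 ->; exists [seq (e.1, ray e.2) | e <- s].
    by apply/allP => _ /mapP[e /s0/andP[? ?] ->]; apply/andP; split=> //; apply/mem_nth.
  by rewrite /combination big_map.
(* Every maximal chain of rays begins with {u}, {u,v} and ends with the full set; only the three
   rays between depend on the ordering. The coefficients are consecutive differences of the sorted
   coordinates. *)
have chain (a b c d e f : R) (i j k : nat) : [/\ 0 <= a, 0 <= b & 0 <= c] ->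
    [/\ 0 <= d, 0 <= e & 0 <= f] -> [&& i < 11, j < 11 & k < 11]%N ->
    (forall l, p 0 l = a * rv (ray 0%N) 0 l + (b * rv (ray 1%N) 0 l +
       (c * rv (ray i) 0 l + (d * rv (ray j) 0 l +
       (e * rv (ray k) 0 l + f * rv (ray 10%N) 0 l))))) ->
    exists2 s, nonneg_on rays s & p = combination s.
  move=> [a0 b0 c0] [d0 e0 f0] /and3P[i11 j11 k11] pE.
  apply: (ok [:: (a, 0); (b, 1); (c, i); (d, j); (e, k); (f, 10)]%N).
    by rewrite /= a0 b0 c0 d0 e0 f0 i11 j11 k11.
  rewrite !big_cons big_nil addr0; apply/rowP => l; rewrite pE.
  by rewrite !mxE.
case: (lerP (yc p) (zc p)) => yz; case: (lerP (xc p) (wc p)) => xw.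
- case: (lerP (xc p) (zc p)) => xz; first case: (lerP (xc p) (yc p)) => xy.
  + apply: (chain (uc p - vc p) (vc p - wc p) (wc p - zc p)
        (zc p - yc p) (yc p - xc p) (xc p) 2%N 6%N 9%N) => //;
    try by split; rewrite ?subr_ge0 // ltW.
    by solve_coordinates.
  + apply: (chain (uc p - vc p) (vc p - wc p) (wc p - zc p)
        (zc p - xc p) (xc p - yc p) (yc p) 2%N 6%N 8%N) => //;
    try by split; rewrite ?subr_ge0 // ltW.
    by solve_coordinates.
  + apply: (chain (uc p - vc p) (vc p - wc p) (wc p - xc p)
        (xc p - zc p) (zc p - yc p) (yc p) 2%N 4%N 8%N) => //;
    try by split; rewrite ?subr_ge0 // ltW.
    by solve_coordinates.
- apply: (chain (uc p - vc p) (vc p - xc p) (xc p - wc p)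
      (wc p - zc p) (zc p - yc p) (yc p) 3%N 4%N 8%N) => //;
    try by split; rewrite ?subr_ge0 // ltW.
  by solve_coordinates.
- case: (lerP (xc p) (yc p)) => xy; first case: (lerP (xc p) (zc p)) => xz.
  + apply: (chain (uc p - vc p) (vc p - wc p) (wc p - yc p)
        (yc p - zc p) (zc p - xc p) (xc p) 2%N 5%N 9%N) => //;
    try by split; rewrite ?subr_ge0 // ltW.
    by solve_coordinates.
  + apply: (chain (uc p - vc p) (vc p - wc p) (wc p - yc p)
        (yc p - xc p) (xc p - zc p) (zc p) 2%N 5%N 7%N) => //;
    try by split; rewrite ?subr_ge0 // ltW.
    by solve_coordinates.
  + apply: (chain (uc p - vc p) (vc p - wc p) (wc p - xc p)
        (xc p - yc p) (yc p - zc p) (zc p) 2%N 4%N 7%N) => //;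
    try by split; rewrite ?subr_ge0 // ltW.
    by solve_coordinates.
- apply: (chain (uc p - vc p) (vc p - xc p) (xc p - wc p)
      (wc p - yc p) (yc p - zc p) (zc p) 3%N 4%N 7%N) => //;
    try by split; rewrite ?subr_ge0 // ltW.
  by solve_coordinates.
Qed.

Lemma lin_combination a s :
  lin a (combination s) = \sum_(e <- s) e.1 * lin a (rv e.2).
Proof.
by rewrite /combination linear_sum; apply: eq_bigr => e _; rewrite linearZ.
Qed.

Lemma pact_combination g s :
  pact g (combination s) = combination [seq (e.1, actb (code g) e.2) | e <- s].
Proof.
rewrite /combination linear_sum big_map; apply: eq_bigr => e _.
by rewrite linearZ /= pact_rv.
Qed.

(** The values of [a] on the terms of a ray decomposition are nonnegative with sum zero, so each of
    them vanishes. *)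
Lemma face_decomposition a p :
  (forall q, fundD q -> 0 <= lin a q) -> fundD p -> lin a p = 0 ->
  exists2 s, nonneg_on [seq r <- rays | lin a (rv r) == 0] s & p = combination s.
Proof.
move=> a0 /fundD_decomposition[s /allP s0 ->].
rewrite lin_combination big_seq => /eqP; rewrite psumr_eq0; last first.
  by move=> e /s0/andP[e0 /fundD_ray er]; rewrite mulr_ge0 ?a0.
(* Terms with coefficient zero may sit on rays off the face and are dropped. *)
move=> /allP sa; exists [seq e <- s | e.1 != 0].
  apply/allP => e; rewrite mem_filter => /andP[en es].
  have /andP[e0 er] := s0 _ es; rewrite e0 mem_filter er andbT /=.
  by have := sa _ es; rewrite es mulf_eq0 (negPf en).
rewrite /combination big_filter [LHS](bigID (fun e => e.1 != 0)) /=.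
by rewrite [X in _ + X]big1 ?addr0 // => e /negPn/eqP->; rewrite scale0r.
Qed.

Definition face_of S : set 'rV[R]_6 :=
  fundD `&` [set p | lin (iv (face_form S)) p = 0].

Lemma faces_rays S r : S \in faces -> r \in S -> r \in rays.
Proof. by rewrite mem_filter => /andP[_ /mapP[m _ ->]] /mem_mask. Qed.

Lemma face_formP S r : S \in faces -> r \in rays ->
  (0 <= lin (iv (face_form S)) (rv r)) *
  ((lin (iv (face_form S)) (rv r) == 0) = (r \in S)).
Proof.
move=> /(allP faces_certified)/and4P[/allP fS _ _ _] /fS/andP[d0 /eqP<-].
by rewrite lin_iv_rv ler0z intr_eq0.
Qed.

Lemma face_form_ge0 S p : S \in faces -> fundD p -> 0 <= lin (iv (face_form S)) p.
Proof.
move=> Sf /fundD_decomposition[s /allP s0 ->]; rewrite lin_combination big_seq.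
apply: sumr_ge0 => e /s0/andP[e0 er]; rewrite mulr_ge0 //.
by have [] := face_formP Sf er.
Qed.

Lemma is_face_face_of S : S \in faces -> is_face (@fundD R) (face_of S).
Proof. by move=> Sf; exists (iv (face_form S)); split=> // p; exact: face_form_ge0. Qed.

Lemma face_ofP S p : S \in faces ->
  face_of S p <-> exists2 s, nonneg_on S s & p = combination s.
Proof.
move=> Sf; split=> [[Dp p0]|[s s0 ->]].
  have [s /allP s0 ->] := face_decomposition (fun q => face_form_ge0 Sf) Dp p0.
  exists s => //; apply/allP => e /s0/andP[->].
  by rewrite mem_filter => /andP[+ er]; have [_ ->] := face_formP Sf er.
split.
  apply: fundD_combination; apply: sub_all s0 => e /andP[-> /=].
  exact: faces_rays.
rewrite /= lin_combination big1_seq // => e /= es.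
have /andP[_ eS] := allP s0 _ es.
have [_] := face_formP Sf (faces_rays Sf eS).
by rewrite eS => /eqP ->; rewrite mulr0.
Qed.

Lemma face_of_ray S r : S \in faces -> r \in S -> face_of S (rv r).
Proof.
move=> Sf rS; apply/face_ofP => //; exists [:: (1, r)].
  by rewrite /nonneg_on /= ler01 rS.
by rewrite /combination big_seq1 scale1r.
Qed.

Lemma rv_meet_join (a b : bitseq) : size a = size b ->
  rv a + rv b = rv (meetb a b) + rv (joinb a b).
Proof.
move=> sab; apply/rowP => j; rewrite !mxE.
have [ja|ja] := ltnP j (size a).
  rewrite /meetb /joinb !(nth_map (false, false)) ?size_zip -?sab ?minnn //.
  rewrite nth_zip //=.
  by case: nth; case: nth; rewrite ?addr0 ?add0r.
by rewrite !nth_default // ?size_map ?size_zip -?sab ?minnn.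
Qed.

Lemma rays_lattice : all (fun r => all (fun r' =>
  [&& size r == size r', meetb r r' \in rays & joinb r r' \in rays]) rays) rays.
Proof. by vm_compute. Qed.

Lemma is_face_in_faces F : is_face (@fundD R) F -> exists2 S, S \in faces & F = face_of S.
Proof.
move=> [a [a0 ->]]; set S := [seq r <- rays | lin a (rv r) == 0].
have Sf : S \in faces.
  rewrite mem_filter; apply/andP; split; last first.
    (* A filter of [rays] is one of its masks, hence is enumerated. *)
    rewrite /S filter_mask; apply/mapP; eexists; last reflexivity.
    by rewrite -(size_map (fun r => lin a (rv r) == 0)) mem_bitseqs.
  apply/allP => r rr; apply/allP => r' rr'.
  have /allP/(_ _ rr)/allP/(_ _ rr')/and3P[/eqP sr mr jr] := rays_lattice.
  rewrite !mem_filter rr rr' mr jr !andbT.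
  (* The two pairs of nonnegative values have the same sum, so one pair vanishes iff the other
     does. *)
  by rewrite -!paddr_eq0 ?a0 //; try exact: fundD_ray; rewrite -!linearD rv_meet_join.
exists S => //; apply/seteqP; split=> p.
  by move=> [Dp /(face_decomposition a0 Dp)[s s0 ->]]; apply/(face_ofP _ Sf); exists s.
move=> /(face_ofP _ Sf)[s s0 ->]; split.
  apply: fundD_combination; apply: sub_all s0 => e /andP[-> /=].
  exact: faces_rays.
rewrite /= lin_combination big1_seq // => e /= es.
have /andP[_] := allP s0 _ es.
by rewrite mem_filter => /andP[/eqP -> _]; rewrite mulr0.
Qed.

(** * Dimensions of faces *)

Lemma foldr_addE (V : nmodType) (F : nat -> V) n :
  foldr (fun j s => F j + s) 0 (iota 0 n) = \sum_(j < n) F j.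
Proof.
rewrite -(big_mkord xpredT) /index_iota subn0.
by elim: iota => [|j s IHs] /=; rewrite ?big_nil // big_cons IHs.
Qed.

Lemma span_dim_face_of S : S \in faces -> span_dim (face_of S) (face_dim S).
Proof.
move=> Sf; have := allP faces_certified _ Sf.
set ch := max_chain S; set du := dual_chain S; rewrite /face_certificate.
rewrite -/ch -/du => /and4P[_ /allP chS /allP dual /allP span].
pose M : 'M[R]_(face_dim S, 6) := \matrix_i rv (nth [::] ch i).
have rowM i : row i M = rv (nth [::] ch i) by rewrite rowK.
exists M; split; first by move=> i; rewrite rowM; apply/face_of_ray/chS/mem_nth.
split.
  (* The dual functionals, taken as columns, form a right inverse of the chain matrix. *)
  apply/eqP/row_freeP; exists (\matrix_(i, j) (iv (nth [::] du j) 0 i)).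
  apply/matrixP => i j; rewrite !mxE.
  have /allP/(_ j) : all (fun j : nat => dotz (nth [::] du j) (nth [::] ch i) ==
      (i == j :> nat)%:Z) (iota 0 (size ch))
    by apply: dual; rewrite mem_iota; exact: ltn_ord.
  rewrite mem_iota => /(_ (ltn_ord j))/eqP/(congr1 (fun z => z%:~R : R)).
  rewrite -lin_iv_rv -pmulrn => <-; rewrite /lin; apply: eq_bigr => l _.
  by rewrite !mxE mulrC.
move=> p /(face_ofP _ Sf)[s /allP s0 ->].
rewrite /combination big_seq; apply: summx_sub => e /s0/andP[_ eS].
(* The coefficients of a ray in the chain are its values under the dual functionals. *)
apply: scalemx_sub; suff -> : rv e.2 =
    \sum_(j < face_dim S) (dotz (nth [::] du j) e.2)%:~R *: row j M.
  by apply: summx_sub => j _; apply: scalemx_sub; exact: row_sub.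
apply/rowP => i; have /allP/(_ i) := span _ eS.
rewrite mem_iota /= ltn_ord => /(_ isT)/eqP/(congr1 (fun z => z%:~R : R)).
rewrite foldr_addE rmorph_sum /= summxE -pmulrn mxE => ->.
by apply: eq_bigr => j _; rewrite rowM !mxE rmorphM /= -pmulrn.
Qed.

(** The rows of each matrix lie in F, hence in the row space of the other. *)
Lemma span_dim_inj (F : set 'rV[R]_6) k k' : span_dim F k -> span_dim F k' -> k = k'.
Proof.
move=> [M [FM [rM MF]]] [M' [FM' [rM' MF']]]; rewrite -rM -rM'.
by apply/eqP; rewrite eqn_leq; apply/andP; split; apply/mxrankS/row_subP => i;
  [exact: MF' | exact: MF].
Qed.

(** * Face orbits and the cell count *)

Lemma face_of_pact g S S' p : S \in faces -> S' \in faces ->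
  {in S, forall r, actb (code g) r \in S'} -> face_of S p -> face_of S' (pact g p).
Proof.
move=> Sf Sf' gS /(face_ofP _ Sf)[s s0 ->]; apply/face_ofP => //.
rewrite pact_combination; eexists; last reflexivity.
apply/allP => _ /mapP[e /(allP s0)/andP[e0 eS] ->] /=.
by rewrite e0 gS.
Qed.

Lemma actbM g h b : actb (code g) (actb (code h) b) = actb (code (g * h)%g) b.
Proof.
rewrite codeM /comp_code /actb -[RHS]map_comp; apply/eq_in_map => _ /mapP[k _ ->].
by rewrite [LHS](nth_map 0%N) ?size_code ?ltn_ord.
Qed.

Lemma face_eqv_equiv S S' : S \in faces -> S' \in faces -> face_eqv S S' ->
  face_equiv (face_of S) (face_of S').
Proof.
move=> Sf Sf' /hasP[c /codes_realized[g gG <-] /andP[/allP gS /allP gS']].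
exists g => //; apply/seteqP; split => [_ [p pS <-]|p pS'].
  exact: face_of_pact pS.
exists (pact g^-1%g p); last by rewrite pactM mulgV pact1.
apply: face_of_pact pS' => // r /gS'/mapP[t tS ->].
rewrite actbM mulVg code1.
(* The identity code fixes exactly the lists of length six. *)
have /eqP t6 : size t == 6%N.
  by move: t {tS} (faces_rays Sf tS); apply/allP; vm_compute.
by rewrite /actb -t6 -/(mkseq _ _) mkseq_nth.
Qed.

Lemma face_equiv_sym (F F' : set 'rV[R]_6) : face_equiv F F' -> face_equiv F' F.
Proof.
move=> [g gG <-]; exists g^-1%g; first exact: groupVr.
rewrite image_comp (_ : _ \o _ = id) ?image_id //.
by apply/funext => p /=; rewrite pactM mulVg pact1.
Qed.

(** The image of a ray of S lies in D, so it is a ray by [codes_rays]; the form of S' vanishes on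
    it, which places it in S'. *)
Lemma face_equiv_le S S' : S \in faces -> S' \in faces ->
  face_equiv (face_of S) (face_of S') -> face_le S S'.
Proof.
move=> Sf Sf' [g gG gS]; have gc := code_in_codes gG.
apply/hasP; exists (code g); first exact: gc.
apply/allP => r rS.
have [] : face_of S' (rv (actb (code g) r)).
  by rewrite -gS; exists (rv r); [exact: face_of_ray | exact: pact_rv].
move=> /rv_fundD gr /eqP.
have /allP/(_ _ gc)/allP/(_ _ (faces_rays Sf rS)) := codes_rays.
rewrite gr /= => grr.
by have [_ ->] := face_formP Sf' grr.
Qed.

Lemma num_cells_fundD k N : count_certificate k N -> num_cells (@fundD R) k N.
Proof.
case/and5P => /eqP sN uq /allP sub /allP sep /allP cover.
pose rep (i : 'I_N) := nth [::] (face_reps k) i.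
have repin i : rep i \in face_reps k by rewrite mem_nth // sN.
have repf i : (face_dim (rep i) = k) * (rep i \in faces).
  have : rep i \in [seq S <- faces | face_dim S == k] := sub _ (repin i).
  by rewrite mem_filter => /andP[/eqP-> ->].
exists (face_of \o rep); split; [|split].
- move=> i; have [<- fi] := repf i; split; first exact: is_face_face_of.
  exact: span_dim_face_of.
- move=> i j ij; apply/val_inj/eqP.
  rewrite -(nth_uniq [::] _ _ uq) ?sN; try exact: ltn_ord.
  have /allP/(_ _ (repin j))/implyP := sep _ (repin i); apply.
  by rewrite !face_equiv_le ?repf //; exact: face_equiv_sym.
- move=> _ /is_face_in_faces[S Sf ->] kS.
  have Sk : S \in [seq S <- faces | face_dim S == k].
    by rewrite mem_filter Sf andbT (span_dim_inj (span_dim_face_of Sf) kS).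
  have /hasP[S' S'r eqS] := cover _ Sk.
  have iN : (index S' (face_reps k) < N)%N by rewrite -sN index_mem.
  exists (Ordinal iN).
  have -> : (face_of \o rep) (Ordinal iN) = face_of S'.
    by congr face_of; exact: nth_index.
  apply: face_eqv_equiv Sf _ eqS.
  have : S' \in [seq S <- faces | face_dim S == k] := sub _ S'r.
  by rewrite mem_filter => /andP[_ S'f]; exact: S'f.
Qed.
End Order_cone.

(** * Coning off singular chains *)

(** A neighbourhood of [v] contains a product of neighbourhoods of its finitely many entries. *)
Lemma cvg_row (T : topologicalType) (I : Type) (F : set_system I) n
    {FF : Filter F} (f : I -> 'rV[T]_n) (v : 'rV[T]_n) :
  (forall j, (fun x => f x 0 j) @ F --> v 0 j) -> f @ F --> v.
Proof.
move=> fv A [P vP sPA].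
have : \forall x \near F, forall j, P 0 j (f x 0 j).
  by apply: filter_forall => j; exact: (fv j _ (vP 0 j)).
by apply: filterS => x Px; apply: sPA => i j; rewrite (ord1 i).
Qed.

Section Simplex.
Variable R : realType.

Lemma std_simplex_le1 n (t : 'rV[R]_n.+1) i : std_simplex t -> t 0 i <= 1.
Proof.
by move=> [t0 <-]; rewrite (bigD1 i) //= lerDl sumr_ge0.
Qed.

Lemma sum_continuous n : continuous (fun t : 'rV[R]_n => \sum_i t 0 i).
Proof.
move=> t; elim: (index_enum _) => [|j s IHs].
  have -> : (fun u : 'rV[R]_n => \sum_(i <- [::]) u 0 i) = cst 0.
    by apply/funext => u; rewrite big_nil.
  exact: cst_continuous.
have -> : (fun u : 'rV[R]_n => \sum_(i <- j :: s) u 0 i) =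
    (fun u => u 0 j + \sum_(i <- s) u 0 i).
  by apply/funext => u; rewrite big_cons.
by apply: continuousD => //; exact: coord_continuous.
Qed.

(** A closed subset of the unit cube. Compactness gives the continuity of cones at their apex. *)
Lemma std_simplex_compact n : compact (@std_simplex R n).
Proof.
have cB : compact [set v : 'rV[R]_n.+1 | forall i, `[0, 1]%classic (v ord0 i)].
  by apply: (@rV_compact R _ (fun=> `[0, 1]%classic)) => _; exact: segment_compact.
apply: subclosed_compact cB _; last first.
  by move=> t tD i /=; rewrite in_itv /= (std_simplex_le1 _ tD) andbT; case: tD.
have -> : @std_simplex R n = (\bigcap_i [set t | 0 <= t 0 i]) `&`
    [set t | \sum_i t 0 i = 1].
  by apply/seteqP; split=> t [t0 t1]; split=> // i; [move=> _|]; apply: t0.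
apply: closedI.
  apply: closed_bigI => i _; apply: (closed_comp _ (@closed_ge _ 0)) => t _.
  exact: coord_continuous.
apply: (closed_comp _ (@closed_eq _ 1)) => t _; exact: sum_continuous.
Qed.

(* The point of the facet opposite to vertex 0 lying on the line through t and
   vertex 0; at that vertex it is the junk value 0. *)
Definition base_proj n (t : 'rV[R]_n.+2) : 'rV[R]_n.+1 :=
  \row_j (t 0 (lift ord0 j) / (1 - t 0 0)).

Lemma base_proj_simplex n (t : 'rV[R]_n.+2) :
  std_simplex t -> t 0 0 != 1 -> std_simplex (base_proj t).
Proof.
move=> tD t1; have t0le := std_simplex_le1 0 tD; case: tD => t0 ts.
have t10 : 1 - t 0 0 > 0 by rewrite subr_gt0 lt_neqAle t1.
split=> [i|]; first by rewrite mxE divr_ge0 // ltW.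
under eq_bigr do rewrite mxE.
have eS : \sum_(i < n.+1) t 0 (lift ord0 i) = 1 - t 0 0.
  by rewrite -ts [in RHS]big_ord_recl addrAC subrr add0r.
by rewrite -mulr_suml eS divff // gt_eqF.
Qed.

Lemma base_proj_cvg n (t : 'rV[R]_n.+2) : t 0 0 != 1 ->
  base_proj u @[u --> t] --> base_proj t.
Proof.
move=> t1; apply: (@cvg_row _ _ (nbhs t) _ _ (@base_proj n)) => j; rewrite mxE.
have -> : (fun u : 'rV[R]_n.+2 => base_proj u 0 j) =
    (fun u => u 0 (lift ord0 j) * (1 - u 0 0)^-1).
  by apply/funext => u; rewrite mxE.
apply: cvgM; first exact: coord_continuous.
apply: cvgV; first by rewrite subr_eq0 eq_sym.
by apply: cvgB; [exact: cst_continuous | exact: coord_continuous].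
Qed.

Lemma coface_lift n (i : 'I_n.+2) (t : 'rV[R]_n.+1) k :
  coface i t 0 (lift i k) = t 0 k.
Proof.
rewrite mxE /= /bump; have [ik|ki] := leqP i k.
  by rewrite add1n ltnNge leqW // gtn_eqF //= inord_val.
by rewrite add0n ki inord_val.
Qed.

Lemma coface_simplex n (i : 'I_n.+2) (t : 'rV[R]_n.+1) :
  std_simplex t -> std_simplex (coface i t).
Proof.
have cfi : coface i t 0 i = 0 by rewrite mxE ltnn eqxx.
move=> [t0 t1]; split=> [j|].
  by case: (unliftP i j) => [k|] ->; rewrite ?cfi // coface_lift.
rewrite (bigD1_ord i) //= cfi add0r -t1.
by apply: eq_bigr => k _; rewrite coface_lift.
Qed.

Lemma coface0_apex n (t : 'rV[R]_n.+1) : coface 0 t 0 0 = 0.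
Proof. by rewrite mxE. Qed.

Lemma base_proj_coface0 n (t : 'rV[R]_n.+1) : base_proj (coface 0 t) = t.
Proof.
by apply/rowP => j; rewrite mxE coface0_apex subr0 divr1 mxE /= inord_val.
Qed.

Lemma cofaceS_apex n i (t : 'rV[R]_n.+1) : coface i.+1 t 0 0 = t 0 0.
Proof. by rewrite mxE /= (_ : inord 0 = 0) //; apply/val_inj; rewrite /= inordK. Qed.

(** Coordinate 0 belongs to the apex, so a zero inserted at [i.+1] appears at [i] among the base
    coordinates, and the scaling is unchanged. *)
Lemma base_proj_cofaceS n i (t : 'rV[R]_n.+2) : (i < n.+2)%N ->
  base_proj (coface i.+1 t) = coface i (base_proj t).
Proof.
move=> i_n; apply/rowP => j; rewrite mxE cofaceS_apex !mxE /= /bump add1n ltnS eqSS.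
have tE (k l : 'I_n.+2) : k = l :> nat -> t 0 k = t 0 l by move/val_inj ->.
case: ltngtP => [ji|ij|_]; rewrite ?mul0r //; congr (_ / _); apply: tE.
  have jn : (j < n.+1)%N by rewrite (leq_trans ji).
  by rewrite /= /bump /= !inordK.
by case: j ij => -[|j] //= jn _; rewrite add0n !inordK.
Qed.

End Simplex.

Section Cone_construction.
Variables (R : realType) (T : topologicalType).

(** The homotopy lives on the whole space and for all real times; that a subset is preserved for
    times in [0,1] is asked separately. *)
Definition contraction (H : T -> R -> T) (c : T) : Prop :=
  [/\ continuous (fun z : T * R => H z.1 z.2),
      forall x, H x 0 = x & forall x, H x 1 = c].

(** Vertex 0 is the apex and its coordinate is the time. At the apex the time is 1, so the junk
    value of [base_proj] is harmless for a contraction. *)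
Definition cone (H : T -> R -> T) n (s : 'rV[R]_n.+1 -> T) : 'rV[R]_n.+2 -> T :=
  fun t => H (s (base_proj t)) (t 0 0).

Definition cone_chain (H : T -> R -> T) n (b : @chain R T n) : @chain R T n.+1 :=
  [seq (p.1, cone H p.2) | p <- b].

Definition agree n (s s' : 'rV[R]_n.+1 -> T) : Prop :=
  forall t, std_simplex t -> s t = s' t.

Lemma cone_coface0 H c n (s : 'rV[R]_n.+1 -> T) t : contraction H c ->
  cone H s (coface 0 t) = s t.
Proof. by move=> [_ H0 _]; rewrite /cone base_proj_coface0 coface0_apex H0. Qed.

Lemma cone_cofaceS H n (s : 'rV[R]_n.+2 -> T) i t : (i < n.+2)%N ->
  cone H s (coface i.+1 t) = cone H (fun u => s (coface i u)) t.
Proof. by move=> i_n; rewrite /cone base_proj_cofaceS // cofaceS_apex. Qed.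

Lemma agree_cone H c n (s s' : 'rV[R]_n.+1 -> T) : contraction H c ->
  agree s s' -> agree (cone H s) (cone H s').
Proof.
move=> [_ _ H1] ss' t tD; rewrite /cone.
have [->|t1] := eqVneq (t 0 0) 1; first by rewrite !H1.
by rewrite ss' //; exact: base_proj_simplex.
Qed.

Lemma singular_cone H c n (A : set T) (s : 'rV[R]_n.+1 -> T) : contraction H c ->
  (forall x t, A x -> 0 <= t <= 1 -> A (H x t)) -> A c ->
  singular A s -> singular A (cone H s).
Proof.
move=> [cH H0 H1] AH Ac [cs sA]; split; last first.
  move=> _ [t tD <-]; rewrite /cone.
  have [->|t1] := eqVneq (t 0 0) 1; first by rewrite H1.
  apply: AH; first by apply: sA; exists (base_proj t) => //; exact: base_proj_simplex.
  by rewrite std_simplex_le1 // andbT; case: tD.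
move/subspace_continuousP in cs; apply/subspace_continuousP => t tD.
rewrite /from_subspace in cs *.
have t0_cvg : (fun u : 'rV[R]_n.+2 => u 0 0) @ t --> t 0 0 by exact: coord_continuous.
have [t1|t1] := eqVneq (t 0 0) 1.
  have -> : cone H s t = c by rewrite /cone t1 H1.
  move=> U Uc.
  (* Tube lemma: for times near 1 the homotopy sends the image of the whole base simplex into U,
     whatever the direction of approach to the apex. *)
  have : \forall r \near (1 : R), @std_simplex R n `<=` (fun u => U (H (s u) r)).
    have /compact_near_coveringP/near_covering_withinP cov := @std_simplex_compact R n.
    apply: (cov R (nbhs (1 : R)) (fun r u => U (H (s u) r)) _) => u uD.
    have : nbhs (s u, 1 : R) [set z | U (H z.1 z.2)] by apply: cH; rewrite /= H1.
    move=> [[V W] /= [sV W1] VW]; exists ([set v | std_simplex v -> V (s v)], W) => /=.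
      by split=> //; exact: cs uD _ sV.
    by move=> [v r] /= [vV Wr] vD; exact: (VW (_, _) (conj (vV vD) Wr)).
  rewrite -t1 => /t0_cvg tU.
  suff: \forall u \near t, std_simplex u -> U (cone H s u) by [].
  near=> u => uD.
  have [u1|u1] := eqVneq (u 0 0) 1.
    by rewrite /cone u1 H1; exact: nbhs_singleton.
  have : @std_simplex R n `<=` (fun v => U (H (s v) (u 0 0))) by near: u.
  by apply; exact: base_proj_simplex.
(* Away from the apex the cone is a composite of continuous maps. *)
move=> U /(cH (s (base_proj t), t 0 0))[[V W] /= [sV Wt] VW].
have ptD := base_proj_simplex tD t1.
have tV := base_proj_cvg t1 (cs _ ptD _ sV).
have t1' : \forall u \near t, (u : 'rV[R]_n.+2) 0 0 != 1.
  by apply: (t0_cvg [set r | r != 1]); apply: open_nbhs_nbhs; split=> //; exact: open_neq.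
have tW := t0_cvg _ Wt.
suff: \forall u \near t, std_simplex u -> U (cone H s u) by [].
near=> u => uD; apply: (VW (_, _)); split => /=.
  have u1 : u 0 0 != 1 by near: u.
  have : std_simplex (base_proj u) -> V (s (base_proj u)) by near: u.
  by apply; exact: base_proj_simplex.
by near: u.
Unshelve. all: by end_near.
Qed.

Lemma coef_boundaryE n (d : @chain R T n.+1) s :
  coef (boundary d) s = \sum_(p <- d) \sum_(i <- iota 0 n.+2)
    (if `[< agree (fun t => p.2 (coface i t)) s >] then (-1) ^+ i * p.1 else 0).
Proof.
rewrite /coef /boundary big_flatten big_map; apply: eq_bigr => p _.
by rewrite big_map.
Qed.

(** A cone is determined by its face 0, so these coefficients depend only on those of [b]. This
    matters because the boundary of a cycle vanishes only coefficientwise, not as a list. *)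
Lemma coef_cone H c n (b : @chain R T n) s : contraction H c ->
  coef (cone_chain H b) s =
  if `[< agree (cone H (fun t => s (coface 0 t))) s >]
  then coef b (fun t => s (coface 0 t)) else 0.
Proof.
move=> Hc; rewrite /coef big_map -/(agree _ _).
rewrite (_ : (if _ then _ else 0) = \sum_(p <- b)
    if `[< agree (cone H (fun t => s (coface 0 t))) s >] &&
       `[< agree p.2 (fun t => s (coface 0 t)) >] then p.1 else 0).
  apply: eq_bigr => p _; rewrite -asbool_and; congr (if _ then _ else _).
  apply: asbool_equiv_eq; split=> [ps|[cs ps]].
    have ps' : agree p.2 (fun t => s (coface 0 t)).
      move=> t tD; rewrite -ps; last exact: (coface_simplex ord0).
      by rewrite /= (cone_coface0 _ _ Hc).
    split=> // t tD; rewrite -ps //; symmetry.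
    exact: agree_cone Hc ps' t tD.
  by move=> t tD; rewrite -cs //; exact: agree_cone Hc ps t tD.
by case: asboolP => _ //=; rewrite big1.
Qed.

(** Face 0 of a cone is its base; face i+1 is the cone on face i, with opposite sign. *)
Lemma coef_boundary_cone H c n (b : @chain R T n.+1) s : contraction H c ->
  coef (boundary (cone_chain H b)) s =
  coef b s - coef (cone_chain H (boundary b)) s.
Proof.
move=> Hc; rewrite coef_boundaryE /coef !big_map /boundary big_flatten big_map.
rewrite -sumrB; apply: eq_bigr => p _; rewrite big_map.
rewrite [iota 0 n.+3]/= big_cons /= expr0 mul1r; congr (_ + _).
  congr (if _ then _ else _); apply: asbool_equiv_eq.
  by split=> ps t tD; rewrite -ps // (cone_coface0 _ _ Hc).
rewrite -sumrN -[1 :: _]/(iota (1 + 0) n.+2) iotaDl big_map.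
rewrite big_seq [RHS]big_seq; apply: eq_bigr => i; rewrite mem_iota => i_n.
rewrite add1n exprS mulN1r mulNr.
rewrite [in RHS]fun_if oppr0 /=; congr (if _ then _ else _).
by apply: asbool_equiv_eq; split=> ps t tD; rewrite -ps //= cone_cofaceS.
Qed.

(** In degree 0 the other face is the constant simplex at c, so the augmentation appears. *)
Lemma coef_boundary_cone0 H c (b : @chain R T 0) s : contraction H c ->
  coef (boundary (cone_chain H b)) s =
  coef b s - (if `[< agree (fun=> c) s >] then \sum_(p <- b) p.1 else 0).
Proof.
move=> Hc; rewrite coef_boundaryE /coef !big_map.
rewrite (_ : (if _ then _ else _) = \sum_(p <- b)
  if `[< agree (fun=> c) s >] then p.1 else 0); last first.
  by case: asboolP => // _; rewrite big1.
rewrite -sumrB; apply: eq_bigr => p _.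
rewrite big_cons big_seq1 /= expr0 mul1r expr1 mulN1r; congr (_ + _).
  congr (if _ then _ else _); apply: asbool_equiv_eq.
  by split=> ps t tD; rewrite -ps // (cone_coface0 _ _ Hc).
rewrite [in RHS]fun_if oppr0 /=; congr (if _ then _ else _).
(* The only coordinate of a point of the 0-simplex is 1, so face 1 of the cone sits at time 1. *)
have cE t : @std_simplex R 0 t -> cone H p.2 (coface 1 t) = c.
  move=> [_]; rewrite big_ord1 /cone cofaceS_apex => ->; by have [_ _ ->] := Hc.
by apply: asbool_equiv_eq; split=> ps t tD; rewrite -ps // cE.
Qed.

Lemma is_chain_cone H c n (A : set T) (b : @chain R T n) : contraction H c ->
  (forall x t, A x -> 0 <= t <= 1 -> A (H x t)) -> A c ->
  is_chain A b -> is_chain A (cone_chain H b).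
Proof.
move=> Hc AH Ac bA q /List.in_map_iff[p [<- pb]].
by apply: singular_cone Hc AH Ac _; exact: bA.
Qed.

(** For a cycle the correction term of the boundary formula vanishes, so its cone bounds it. *)
Lemma contraction_reduced_acyclic H c (A : set T) : contraction H c ->
  (forall x t, A x -> 0 <= t <= 1 -> A (H x t)) -> A c ->
  @reduced_acyclic R T A.
Proof.
move=> Hc AH Ac; split; first by exists c.
split=> [b bA b0|n b bA db]; exists (cone_chain H b); split;
  try exact: is_chain_cone Hc AH Ac bA.
  by move=> s; rewrite (coef_boundary_cone0 _ _ Hc) b0 if_same subr0.
move=> s; rewrite (coef_boundary_cone _ _ Hc) (coef_cone _ _ Hc).
by rewrite db if_same subr0.
Qed.

End Cone_construction.

(** * The link *)

Section Link.
Variable R : realType.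
Implicit Types p : 'rV[R]_6.

Lemma qK4_pact g p : g \in GK4 -> qK4 (pact g p) = qK4 p.
Proof.
move=> gG; apply/eqmodP; rewrite /= orbit_rel_sym.
by apply/existsP; exists g; rewrite gG /=.
Qed.

Lemma qK4_eq p p' : qK4 p = qK4 p' -> exists2 g, g \in GK4 & pact g p = p'.
Proof. by move/eqmodP => /existsP[g /andP[gG /eqP]]; exists g. Qed.

Lemma pact_continuous g : continuous (pact g : 'rV[R]_6 -> 'rV[R]_6).
Proof.
move=> p; apply: (@cvg_row _ _ (nbhs p) _ _ (@pact R g)) => j.
have -> : (fun q : 'rV[R]_6 => pact g q 0 j) = (fun q => q 0 (g j)).
  by apply/funext => q; rewrite mxE.
by rewrite mxE; exact: coord_continuous.
Qed.

(** G acts by homeomorphisms, so the saturation of an open set is a union of open translates.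
    Openness of the quotient map makes the descended homotopy jointly continuous in point and
    time. *)
Lemma qK4_open p (V : set 'rV[R]_6) : nbhs p V -> nbhs (qK4 p) (qK4 @` V).
Proof.
move=> pV; pose U := V°; have Up : U p by exact: nbhs_singleton (nbhs_interior pV).
have oU : open U by exact: open_interior.
have UV : U `<=` V by exact: interior_subset.
suff : nbhs (qK4 p) (qK4 @` U) by apply: filterS; exact: image_subset.
apply: open_nbhs_nbhs; split; last by exists p.
rewrite /open /= /quotient_open.
rewrite (_ : _ @^-1` _ = \bigcup_(g in [set g | g \in GK4]) (pact g @^-1` U)).
  apply: bigcup_open => g _; move/continuousP: (@pact_continuous g); exact.
apply/seteqP; split=> [q [u Uu /esym/qK4_eq[g gG gq]]|q [g gG Ugq]].
  by exists g => //=; rewrite gq.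
by exists (pact g q) => //; exact: qK4_pact.
Qed.

Definition barycenter : 'rV[R]_6 := const_mx 6^-1.

Definition pull (p : 'rV[R]_6) (t : R) : 'rV[R]_6 :=
  (1 - t) *: p + t *: barycenter.

(** Independent of the chosen representative, because [pull] commutes with G. *)
Definition link_homotopy (x : @MK4 R) (t : R) : @MK4 R := qK4 (pull (repr x) t).

Lemma pact_pull g p t : pact g (pull p t) = pull (pact g p) t.
Proof. by apply/rowP => i; rewrite !mxE. Qed.

Lemma link_homotopyE p t : link_homotopy (qK4 p) t = qK4 (pull p t).
Proof.
have /qK4_eq[g gG gp] : qK4 p = qK4 (repr (qK4 p)) by rewrite /qK4 reprK.
by rewrite /link_homotopy -gp -pact_pull qK4_pact.
Qed.

Lemma link_contraction : contraction link_homotopy (qK4 barycenter).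
Proof.
split=> [[x t] U /= Uxt|x|x]; last 2 first.
- by rewrite /link_homotopy /pull subr0 scale1r scale0r addr0 /qK4 reprK.
- by rewrite /link_homotopy /pull subrr scale0r add0r scale1r.
have xE : x = qK4 (repr x) by rewrite /qK4 reprK.
(* Continuity is checked upstairs at the chosen representative; [qK4_open] brings the neighbourhood
   down. *)
have pull_cvg : (fun z : 'rV[R]_6 * R => pull z.1 z.2) @ (repr x, t) -->
    pull (repr x) t.
  apply: cvgD; last by apply: cvgZr_tmp; exact: cvg_snd.
  apply: cvgZ; last exact: cvg_fst.
  by apply: cvgB; [exact: cvg_cst | exact: cvg_snd].
have [[V W] /= [pV tW] VW] := pull_cvg _ (pi_continuous Uxt).
exists (qK4 @` V, W); first by split=> //=; rewrite {1}xE; exact: qK4_open.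
move=> [_ r] /= [[p Vp <-] Wr]; rewrite link_homotopyE.
exact: (VW (p, r)).
Qed.

Lemma linkK4_acyclic : @reduced_acyclic R _ (@linkK4 R).
Proof.
have b_honeycomb : honeycomb barycenter.
  rewrite /honeycomb /X1 /xc /yc /zc /uc /vc /wc /= !mxE; split.
    by move=> i; rewrite mxE invr_ge0 ler0n.
  by rewrite !maxxx lexx.
have sum_pull p t : \sum_i pull p t 0 i = (1 - t) * (\sum_i p 0 i) + t.
  under eq_bigr do rewrite !mxE.
  rewrite big_split /= -!mulr_sumr; congr (_ + _).
  by rewrite sumr_const card_ord -[_ *+ _]mulr_natr mulVf ?mulr1 // pnatr_eq0.
apply: (contraction_reduced_acyclic link_contraction).
  move=> _ t [p [[g gG [p0 p0h <-]] /= p1] <-] /andP[t0 t1].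
  rewrite link_homotopyE; exists (pull (pact g p0) t) => //; split; last first.
    by rewrite /= sum_pull p1; ring.
  (* The same g serves along the whole segment. *)
  exists g => //; exists (pull p0 t); last by rewrite pact_pull.
  move: p0h b_honeycomb; rewrite /honeycomb /X1 /xc /yc /zc /uc /vc /wc /=.
  rewrite !ge_max => -[p00 [/andP[? ?] [/andP[? ?] /andP[? ?]]]] [b0 _].
  split=> [i|]; first by rewrite !mxE addr_ge0 ?mulr_ge0 ?subr_ge0.
  (* All coordinates of the barycenter are equal, so the order of coordinates is preserved. *)
  have le1 i j : p0 0 i <= p0 0 j -> pull p0 t 0 i <= pull p0 t 0 j.
    by move=> ij; rewrite !mxE lerD2r ler_wpM2l ?subr_ge0.
  by rewrite !le1.
exists barycenter => //; split.
  by exists 1%g => /=; rewrite ?group1 //; exists barycenter => //; rewrite pact1.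
(* At p = 0 and t = 1 this is the coordinate sum of the barycenter. *)
have := sum_pull 0 1; rewrite subrr mul0r add0r /pull scaler0 add0r scale1r.
exact.
Qed.
End Link.

Theorem mainTheorem7 (R : realType) :
  [/\ num_cells (@fundD R) 1 7, num_cells (@fundD R) 2 18,
      num_cells (@fundD R) 3 25, num_cells (@fundD R) 4 21
    & num_cells (@fundD R) 5 8] /\
  reduced_acyclic (R := R) (@linkK4 R).
Proof.
split; last exact: linkK4_acyclic.
by have /and5P[? ? ? ? ?] := face_counts; split; exact: num_cells_fundD.
Qed.
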